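(* Let $\mathcal{T}_h$ be a conforming triangulation of a bounded polygonal domain $\Omega\subset\mathbb{R}^2$, let $k\ge 1$, $g>0$, $\Delta t>0$, let $\mathcal{V}_h^k$ be the space of (discontinuous) piecewise polynomials of degree at most $k$ on $\mathcal{T}_h$, and let $B_h\in\mathcal{V}_h^k$ be the discrete bottom topography. For $K\in\mathcal{T}_h$ let $R^*_{h,K}(U_h,\phi,B_h)$ be the residual of the discontinuous Galerkin scheme with hydrostatic reconstruction for the shallow water equations defined in the context, all integrals being evaluated exactly. Let $\tilde U_h=(\tilde h_h,\tilde m_h,\tilde w_h)^T\in(\mathcal{V}_h^k)^3$ with $\tilde h_h\ge 0$, and let $U_h^{(1)},U_h^{(2)},U_h^{n+1}\in(\mathcal{V}_h^k)^3$ be given by the Runge-Kutta DG scheme: for all $K\in\mathcal{T}_h$ and all $\phi\in\mathcal{V}_h^k$, $$\int_K U_h^{(1)}\phi\,d\bm{x}=\int_K\tilde U_h\phi\,d\bm{x}+\Delta t\,R^*_{h,K}(\tilde U_h,\phi,B_h),$$ $$\int_K U_h^{(2)}\phi\,d\bm{x}=\tfrac34\int_K\tilde U_h\phi\,d\bm{x}+\tfrac14\int_K U_h^{(1)}\phi\,d\bm{x}+\tfrac{\Delta t}{4}R^*_{h,K}(U_h^{(1)},\phi,B_h),$$ $$\int_K U_h^{n+1}\phi\,d\bm{x}=\tfrac13\int_K\tilde U_h\phi\,d\bm{x}+\tfrac23\int_K U_h^{(2)}\phi\,d\bm{x}+\tfrac{2\Delta t}{3}R^*_{h,K}(U_h^{(2)},\phi,B_h).$$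 Then the scheme is well-balanced: if $\tilde U_h$ is a discrete lake-at-rest state, i.e. there is a constant $C$ such that $$\tilde h_h+B_h=C,\qquad \tilde m_h=0,\qquad \tilde w_h=0\quad\text{on every } K\in\mathcal{T}_h,$$ then $U_h^{n+1}=(h_h^{n+1},m_h^{n+1},w_h^{n+1})^T$ is also a discrete lake-at-rest state with the same constant, i.e. $h_h^{n+1}+B_h=C$, $m_h^{n+1}=0$, $w_h^{n+1}=0$ on every $K\in\mathcal{T}_h$.
   Context: The shallow water equations are $U_t+\nabla\cdot\mathbf{F}(U)=S(h,B)$ with $U=(h,m,w)^T$, where $h$ is the water depth, $(m,w)=(hu,hv)$ are the discharges, $(u,v)$ is the velocity, $g$ is the gravitational constant and $B$ is the bottom topography. Here $\mathbf{F}(U)=(F(U),G(U))$ with $$F(U)=\Big(m,\ \tfrac{m^2}{h}+\tfrac12gh^2,\ \tfrac{mw}{h}\Big)^T,\quad G(U)=\Big(w,\ \tfrac{mw}{h},\ \tfrac{w^2}{h}+\tfrac12gh^2\Big)^T,\quad S(h,B)=(0,-ghB_x,-ghB_y)^T.$$ For $\bm n=(n_x,n_y)$, $\mathbf{F}(U)\cdot\bm n=F(U)n_x+G(U)n_y$, and $\mathbf{F}(U)\cdot\nabla\phi=F(U)\phi_x+G(U)\phi_y$. Convention: where $h=0$, velocities are set to $u=v=0$, so the quotients $m^2/h$, $mw/h$, $w^2/h$, and the reconstructed discharges below, are $0$ there. DG space: $\mathcal{V}_h^k=\{q\in L^2(\Omega): q|_K\in\mathbb{P}^k(K)\ \forall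 K\in\mathcal{T}_h\}$, where $\mathbb{P}^k(K)$ is the set of polynomials of degree at most $k$ on $K$. Derivatives of $B_h$ in $S(h_h,B_h)$ are taken elementwise. Traces: on an edge $e_K$ of $K$ with outward unit normal $\bm n_K^e$, the superscript $int$ denotes the trace of a piecewise polynomial from inside $K$, and $ext$ the trace from the neighboring element sharing the edge. For edges on $\partial\Omega$, the exterior values are supplied by the boundary conditions, which are assumed compatible with the lake-at-rest state: whenever the discrete solution is a lake-at-rest state with constant $C$, the exterior boundary values satisfy $h^{ext}\ge0$, $h^{ext}+B^{ext}=C$, $m^{ext}=w^{ext}=0$ (e.g. periodic boundary conditions). Lax-Friedrichs flux: for states $U^{int},U^{ext}$, $$\hat{\mathbf F}(U^{int},U^{ext},\bm n)=\tfrac12\Big((\mathbf F(U^{int})+\mathbf F(U^{ext}))\cdot\bm n-\alpha(U^{ext}-U^{int})\Big),$$ where $\alpha$ is the maximum, over all elements, edges and both traces, of the absolute values of $un_x+vn_y$ and $un_x+vn_y\pm\sqrt{gh}$. Hydrostatic reconstruction: on each edge $e_K$ put $$h^{*,int}=\max\big(0,\ h^{int}+B^{int}-\max(B^{int},B^{ext})\big),\quad h^{*,ext}=\max\big(0,\ h^{ext}+B^{ext}-\max(B^{int},B^{ext})\big),$$ where $h,B$ stand for $h_h,B_h$, and $$U^{*,int}=\Big(h^{*,int},\tfrac{h^{*,int}}{h^{int}}m^{int},\tfrac{h^{*,int}}{h^{int}}w^{int}\Big)^T,\quad U^{*,ext}=\Big(h^{*,ext},\tfrac{h^{*,ext}}{h^{ext}}m^{ext},\tfrac{h^{*,ext}}{h^{ext}}w^{ext}\Big)^T.$$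 The modified flux is $$\hat{\mathbf F}^*|_{e_K}=\hat{\mathbf F}(U^{*,int},U^{*,ext},\bm n_K^e)+\Delta^*_{e_K}\bm n_K^e,\qquad \Delta^*_{e_K}=\begin{pmatrix}0&0\\ d&0\\ 0&d\end{pmatrix},\quad d=\tfrac g2(h^{int})^2-\tfrac g2(h^{*,int})^2 .$$ Residual: $$R^*_{h,K}(U_h,\phi,B_h)=\int_K S(h_h,B_h)\phi\,d\bm x+\int_K\mathbf F(U_h)\cdot\nabla\phi\,d\bm x-\sum_{e_K\subset\partial K}\int_{e_K}\phi\,\hat{\mathbf F}^*|_{e_K}\,ds,$$ where on $\partial K$ the values of $\phi$ are the traces from inside $K$. *)

(* Defs.v *)
From HB Require Import structures.
From mathcomp Require Import all_boot all_order all_algebra.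
From mathcomp Require Import all_classical all_reals all_analysis.

Set Implicit Arguments.
Unset Strict Implicit.
Unset Printing Implicit Defensive.

Import Order.TTheory GRing.Theory Num.Theory.
Import numFieldNormedType.Exports.

Local Open Scope classical_set_scope.
Local Open Scope ring_scope.

Section PlaneGeometry.
Variable R : realType.
Implicit Types (a b x : R * R) (Om : set (R * R)).

Definition seg_pt a b (t : R) : R * R :=
  (a.1 + t * (b.1 - a.1), a.2 + t * (b.2 - a.2)).

Definition segment a b : set (R * R) := [set seg_pt a b t | t in `[0, 1]].

Definition dist2 a b : R := Num.sqrt ((b.1 - a.1) ^+ 2 + (b.2 - a.2) ^+ 2).

Definition boundary Om : set (R * R) := closure Om `&` closure (~` Om).

Definition bounded_polygonal_domain Om : Prop :=
  [/\ Om !=set0, open Om, connected Om, bounded_set Om &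
      exists s : seq ((R * R) * (R * R)),
        boundary Om = \bigcup_(ab in [set` s]) segment ab.1 ab.2].

Definition lebesgue2 := (@lebesgue_measure R \x @lebesgue_measure R)%E.

(* Arc-length integral over the segment from a to b. *)
Definition segment_integral a b (f : R * R -> R) : R :=
  dist2 a b * \int[@lebesgue_measure R]_(t in `[0%R, 1%R]) f (seg_pt a b t).

End PlaneGeometry.

Section Mesh.
Variables (R : realType) (T : finType).

(* A mesh is the family of the three vertices of its triangles.  Edge i of a  *)
(* triangle is the one opposite to vertex i; ordS is the cyclic successor     *)
(* on 'I_3.                                                                   *)
Variable vtx : T -> 'I_3 -> R * R.
Implicit Types (K : T) (i : 'I_3) (x : R * R).

Definition e_src K i := vtx K (ordS i).
Definition e_tgt K i := vtx K (ordS (ordS i)).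

Definition edge K i : set (R * R) := segment (e_src K i) (e_tgt K i).

Definition triangle K : set (R * R) :=
  [set x | exists l : 'I_3 -> R,
     [/\ forall i, 0 <= l i, \sum_i l i = 1 &
         x = (\sum_i l i * (vtx K i).1, \sum_i l i * (vtx K i).2)]].

Definition nondegenerate K : Prop :=
  let a := vtx K 0 in let b := vtx K 1 in let c := vtx K 2%:R in
  (b.1 - a.1) * (c.2 - a.2) - (b.2 - a.2) * (c.1 - a.1) != 0.

Definition conforming_triangulation (Om : set (R * R)) : Prop :=
  [/\ forall K, nondegenerate K,
      closure Om = \bigcup_K triangle K &
      forall K K', K != K' ->
        [\/ triangle K `&` triangle K' = set0,
            exists i j, vtx K i = vtx K' j /\
                        triangle K `&` triangle K' = [set vtx K i] |
            exists i j, edge K i = edge K' j /\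
                        triangle K `&` triangle K' = edge K i]].

(* Outward unit normal: the edge direction rotated by a right angle and       *)
(* normalised, the sign being chosen so that it points away from vertex i.    *)
Definition normal K i : R * R :=
  let a := e_src K i in let b := e_tgt K i in let c := vtx K i in
  let nx := b.2 - a.2 in let ny := a.1 - b.1 in
  let s := - Num.sg (nx * (c.1 - a.1) + ny * (c.2 - a.2)) in
  (s * nx / dist2 a b, s * ny / dist2 a b).

(* The element on the other side of edge i of K.  In a conforming             *)
(* triangulation of Om it is None exactly when the edge lies on the boundary. *)
Definition neighbor (Om : set (R * R)) K i : option T :=
  [pick K' | (K' != K) &&
     `[< (exists j, edge K' j = edge K i) /\
         ~ (edge K i `<=` boundary Om) >]].

End Mesh.

(* A piecewise polynomial is the family of its restrictions to the elements.  *)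
(* The restriction to K is the bivariate polynomial p (outer variable x,      *)
(* inner variable y, value at the point x being p.[x.1%:P].[x.2]), whose      *)
(* value at a point of an edge of K is thus the trace from inside K.          *)
Section DGSpace.
Variables (R : realType) (T : finType).
Implicit Types (p : {poly {poly R}}) (x : R * R) (K : T).

Definition peval p x : R := p.[x.1%:P].[x.2].

Definition dX p : {poly {poly R}} := p^`().
Definition dY p : {poly {poly R}} := map_poly (@deriv R) p.

Definition deg_le (k : nat) p : Prop :=
  forall i j, (k < i + j)%N -> p`_i`_j = 0.

Definition dgfun := T -> {poly {poly R}}.
Definition dgstate := 'I_3 -> dgfun.

Definition dg_space (k : nat) (q : dgfun) : Prop := forall K, deg_le k (q K).

Definition dg_space3 (k : nat) (U : dgstate) : Prop :=
  forall c, dg_space k (U c).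

(* Components 0, 1, 2 of a state are h, m, w. *)
Definition state := 'cV[R]_3.
Definition mkstate (h m w : R) : state := \col_c [:: h; m; w]`_c.
Definition hh (V : state) : R := V 0 0.
Definition mm (V : state) : R := V 1 0.
Definition ww (V : state) : R := V 2%:R 0.

Definition steval (U : dgstate) K x : state := \col_c peval (U c K) x.

End DGSpace.

(* Since 0^-1 = 0, every quotient by h below is 0 where h = 0, in accordance  *)
(* with the dry-bed convention u = v = 0.                                     *)
Section ShallowWater.
Variables (R : realType) (g : R).
Implicit Types (V W : state R) (n : R * R).

Definition fluxF V : state R :=
  mkstate (mm V) (mm V ^+ 2 / hh V + g / 2 * hh V ^+ 2) (mm V * ww V / hh V).

Definition fluxG V : state R :=
  mkstate (ww V) (mm V * ww V / hh V) (ww V ^+ 2 / hh V + g / 2 * hh V ^+ 2).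

Definition fluxdot V n : state R := n.1 *: fluxF V + n.2 *: fluxG V.

Definition source (h Bx By : R) : state R :=
  mkstate 0 (- (g * h * Bx)) (- (g * h * By)).

Definition LF_flux (alpha : R) V W n : state R :=
  2^-1 *: (fluxdot V n + fluxdot W n - alpha *: (W - V)).

Definition normal_velocity V n : R := mm V / hh V * n.1 + ww V / hh V * n.2.

Definition wave_speeds V n : set R :=
  let un := normal_velocity V n in let c := Num.sqrt (g * hh V) in
  [set `|un|; `|un + c|; `|un - c|].

Definition hstar V (BV Bmax : R) : R := Num.max 0 (hh V + BV - Bmax).

Definition Ustar V (BV Bmax : R) : state R :=
  let hs := hstar V BV Bmax in
  mkstate hs (hs / hh V * mm V) (hs / hh V * ww V).

Definition Delta_star V (BV Bmax : R) : 'M[R]_(3, 2) :=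
  let d := g / 2 * hh V ^+ 2 - g / 2 * hstar V BV Bmax ^+ 2 in
  \matrix_(r, c) (if (r == c.+1 :> nat) then d else 0).

Definition vec n : 'cV[R]_2 := \col_c [:: n.1; n.2]`_c.

Definition modified_flux (alpha : R) V BV W BW n : state R :=
  let Bmax := Num.max BV BW in
  LF_flux alpha (Ustar V BV Bmax) (Ustar W BW Bmax) n
  + Delta_star V BV Bmax *m vec n.

End ShallowWater.

Section Scheme.
Variables (R : realType) (T : finType) (g : R) (Om : set (R * R)).
Variable vtx : T -> 'I_3 -> R * R.

(* Boundary conditions: from the discrete solution, the exterior state and    *)
(* the exterior bottom elevation at a point of a boundary edge.               *)
Definition boundary_data :=
  dgstate R T -> T -> 'I_3 -> R * R -> state R * R.

Variables (bc : boundary_data) (B : dgfun R T).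
Implicit Types (U : dgstate R T) (phi : dgfun R T) (K : T) (i : 'I_3)
  (x : R * R).

Definition ext_trace U K i x : state R * R :=
  if neighbor vtx Om K i is Some K' then (steval U K' x, peval (B K') x)
  else bc U K i x.

(* The speeds are those of the traces of U itself (not of the reconstructed   *)
(* states); sup is the maximum whenever the latter exists.                    *)
Definition alpha_max U : R :=
  sup [set s | exists K i x, edge vtx K i x /\
     (wave_speeds g (steval U K x) (normal vtx K i) s \/
      wave_speeds g (ext_trace U K i x).1 (normal vtx K i) s)].

Definition numflux U K i x : state R :=
  let Uext := ext_trace U K i x in
  modified_flux g (alpha_max U) (steval U K x) (peval (B K) x)
    Uext.1 Uext.2 (normal vtx K i).

Definition elt_integral K (f : R * R -> state R) : state R :=
  \col_c \int[@lebesgue2 R]_(x in triangle vtx K) f x c 0.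

Definition edge_integral K i (f : R * R -> state R) : state R :=
  \col_c segment_integral (e_src vtx K i) (e_tgt vtx K i) (fun x => f x c 0).

Definition residual U phi K : state R :=
  elt_integral K (fun x => peval (phi K) x *:
     source g (hh (steval U K x)) (peval (dX (B K)) x) (peval (dY (B K)) x))
  + elt_integral K (fun x => fluxdot g (steval U K x)
       (peval (dX (phi K)) x, peval (dY (phi K)) x))
  - \sum_(i < 3) edge_integral K i (fun x => peval (phi K) x *: numflux U K i x).

Definition mass U phi K : state R :=
  elt_integral K (fun x => peval (phi K) x *: steval U K x).

Definition nonneg_depth U : Prop :=
  forall K x, triangle vtx K x -> 0 <= hh (steval U K x).

Definition lake_at_rest (C : R) U : Prop :=
  forall K x, triangle vtx K x ->
    [/\ hh (steval U K x) + peval (B K) x = C,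
        mm (steval U K x) = 0 & ww (steval U K x) = 0].

(* Only lake-at-rest states with nonnegative depth are constrained: without   *)
(* that restriction, 0 <= h_ext would fail for periodic boundary conditions.  *)
Definition bc_compatible (k : nat) : Prop :=
  forall U C, dg_space3 k U -> nonneg_depth U -> lake_at_rest C U ->
  forall K i x, neighbor vtx Om K i = None -> edge vtx K i x ->
    [/\ 0 <= hh (bc U K i x).1, hh (bc U K i x).1 + (bc U K i x).2 = C,
        mm (bc U K i x).1 = 0 & ww (bc U K i x).1 = 0].

Definition rkdg_step (k : nat) (dt : R) U0 U1 U2 Un : Prop :=
  forall K phi, dg_space k phi ->
  [/\ mass U1 phi K = mass U0 phi K + dt *: residual U0 phi K,
      mass U2 phi K = (3 / 4) *: mass U0 phi K + (1 / 4) *: mass U1 phi K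
                      + (dt / 4) *: residual U1 phi K &
      mass Un phi K = (1 / 3) *: mass U0 phi K + (2 / 3) *: mass U2 phi K
                      + (2 * dt / 3) *: residual U2 phi K].

End Scheme.

(* Main.v *)
Require Import Defs.
From HB Require Import structures.
From mathcomp Require Import all_boot all_order all_algebra.
From mathcomp Require Import all_classical all_reals all_analysis.
From mathcomp Require Import measurable_realfun ring lra.
Import Order.TTheory GRing.Theory Num.Theory.
Import numFieldNormedType.Exports.
Local Open Scope classical_set_scope.
Local Open Scope ring_scope.
(** A lake at rest has [hh + B = C] and zero discharge, so hydrostatic
    reconstruction yields the same depth on both sides of every edge and the
    modified flux collapses to the pressure [g / 2 * hh ^ 2] times the normal,
    taken from the inside.  With [hh = C - B] a polynomial on each element, the
    residual is then the divergence theorem on the triangle for the polynomial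
    [g / 2 * hh ^ 2 * phi].  Hence every Runge-Kutta stage has the same moments
    against the space as the initial state, and testing with the difference of
    the two states shows that they coincide on each triangle.

    The divergence theorem is obtained by sorting the vertices by abscissa and
    integrating over vertical slices, which are intervals bounded by the heights
    of two edges; sums of line integrals over the oriented boundary and the sign
    of the cross product are both alternating in the vertices. *)

Set Implicit Arguments.
Unset Strict Implicit.
Unset Printing Implicit Defensive.

(** * Bivariate polynomials and their traces on lines *)

Section BivariatePolynomials.
Variable R : realType.
Implicit Types (p q : {poly {poly R}}) (x : R * R) (c : R) (r l : {poly R}).

Lemma peval_swap p x : peval p x = peval (swapXY p) (x.2, x.1).
Proof. by rewrite /peval horner2_swapXY. Qed.

Lemma pevalD p q x : peval (p + q) x = peval p x + peval q x.
Proof. by rewrite /peval !hornerD. Qed.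

Lemma pevalN p x : peval (- p) x = - peval p x.
Proof. by rewrite /peval !hornerN. Qed.

Lemma pevalB p q x : peval (p - q) x = peval p x - peval q x.
Proof. by rewrite pevalD pevalN. Qed.

Lemma pevalM p q x : peval (p * q) x = peval p x * peval q x.
Proof. by rewrite /peval !hornerM. Qed.

Lemma pevalC c x : peval c%:P%:P x = c.
Proof. by rewrite /peval !hornerC. Qed.

Lemma peval_sum p x :
  peval p x = \sum_(i < size p) (p`_i).[x.2] * x.1 ^+ i.
Proof.
rewrite /peval [p.[_]]horner_coef horner_sum; apply: eq_bigr => i _.
by rewrite hornerM horner_exp hornerC.
Qed.

(** Restriction of [p] to a polynomial curve, kept as a univariate polynomial so that the
    fundamental theorem of calculus applies to it. *)
Definition trace p l1 l2 : {poly R} := \sum_(i < size p) (p`_i \Po l2) * l1 ^+ i.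

Lemma horner_trace p l1 l2 c : (trace p l1 l2).[c] = peval p (l1.[c], l2.[c]).
Proof.
rewrite peval_sum horner_sum; apply: eq_bigr => i _.
by rewrite hornerM horner_exp horner_comp.
Qed.

(** This turns the integral of [dY p] over a vertical slice into a one-variable integral of a
    derivative. *)
Lemma dYE p c : (p.[c%:P])^`() = (dY p).[c%:P].
Proof.
rewrite [dY p]/map_poly -[in LHS](coefK p) !horner_poly raddf_sum /=.
apply: eq_bigr => i _.
by rewrite -polyC_exp derivM derivC mulr0 addr0.
Qed.

Lemma swapXY_dX p : swapXY (dX p) = dY (swapXY p).
Proof.
apply/polyP => i; apply/polyP => j.
rewrite coef_swapXY /dX coef_deriv /dY coef_map_id0 ?deriv0// coef_deriv.
by rewrite coef_swapXY coefMn.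
Qed.

Lemma dXM p q : dX (p * q) = dX p * q + p * dX q.
Proof. exact: derivM. Qed.

(** Transported from [dXM]: [swapXY] is a ring morphism that exchanges the two partial
    derivatives. *)
Lemma dYM p q : dY (p * q) = dY p * q + p * dY q.
Proof.
apply: (can_inj (@swapXYK R)).
have dXs (u : {poly {poly R}}) : swapXY (dY u) = dX (swapXY u).
  by have := swapXY_dX (swapXY u); rewrite swapXYK => <-; rewrite swapXYK.
by rewrite dXs !rmorphM rmorphD/= !rmorphM/= !dXs dXM.
Qed.

Lemma dXB p q : dX (p - q) = dX p - dX q.
Proof. exact: derivB. Qed.

Lemma dYB p q : dY (p - q) = dY p - dY q.
Proof. exact: raddfB. Qed.

Lemma dXC c : dX (c%:P%:P) = 0.
Proof. exact: derivC. Qed.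

Lemma dYC c : dY (c%:P%:P) = 0.
Proof. by rewrite /dY map_polyC/= derivC. Qed.

Lemma continuous_peval p : continuous (peval p).
Proof.
move=> x.
rewrite (_ : peval p = fun z => \sum_(i < size p) (p`_i).[z.2] * z.1 ^+ i); last first.
  by apply/funext => z; rewrite peval_sum.
apply: cvg_big => [|i _]; first exact: add_continuous.
apply: cvgM.
  apply: (@continuous_comp _ _ _ snd (horner p`_i)); first exact: cvg_snd.
  exact: continuous_horner.
apply: (@continuous_comp _ _ _ fst (fun z : R => z ^+ i)); first exact: cvg_fst.
exact: exprn_continuous.
Qed.

Lemma measurable_horner r : measurable_fun setT (horner r).
Proof. apply: continuous_measurable_fun; exact: continuous_horner. Qed.

Lemma measurable_peval p : measurable_fun setT (peval p).
Proof.
rewrite (_ : peval p = fun z => \sum_(i < size p) (p`_i).[z.2] * z.1 ^+ i); last first.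
  by apply/funext => z; rewrite peval_sum.
apply: measurable_sum => i; apply: measurable_funM.
  exact: measurableT_comp (measurable_horner _) measurable_snd.
apply: measurable_funX; exact: measurable_fst.
Qed.

Definition primitive r : {poly R} :=
  \poly_(i < (size r).+1) (if i is j.+1 then r`_j / i%:R else 0).

Lemma deriv_primitive r : (primitive r)^`() = r.
Proof.
apply/polyP => i; rewrite coef_deriv coef_poly ltnS.
case: ltnP => ir; last by rewrite mul0rn nth_default.
by rewrite -[LHS]mulr_natr divfK// pnatr_eq0.
Qed.

Lemma continuous_within_horner r (A : set R) : {within A, continuous (horner r)}.
Proof. exact/continuous_subspaceT/continuous_horner. Qed.

Lemma integrable_horner r (a b : R) :
  (@lebesgue_measure R).-integrable `[a, b] (EFin \o horner r).
Proof.
apply: continuous_compact_integrable; first exact: segment_compact.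
exact: continuous_within_horner.
Qed.

Lemma integral_deriv r (a b : R) : a <= b ->
  (\int[@lebesgue_measure R]_(t in `[a, b]) (r^`()).[t]%:E)%E
   = (r.[b] - r.[a])%:E.
Proof.
rewrite le_eqVlt => /predU1P[<-|ab].
  by rewrite set_itv1 integral_set1 subrr.
rewrite (continuous_FTC2 (F := horner r) ab) ?EFinB//.
- exact: continuous_within_horner.
- split; first by move=> x _; exact: derivable_horner.
  + by apply: cvg_at_right_filter; exact: continuous_horner.
  + by apply: cvg_at_left_filter; exact: continuous_horner.
- by move=> x _; rewrite -derivE.
Qed.

Lemma Rintegral_deriv r (a b : R) : a <= b ->
  \int[@lebesgue_measure R]_(t in `[a, b]) (r^`()).[t] = r.[b] - r.[a].
Proof. by move=> ab; rewrite /Rintegral integral_deriv. Qed.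

Lemma Rintegral_horner r (a b : R) : a <= b ->
  \int[@lebesgue_measure R]_(t in `[a, b]) r.[t] =
  (primitive r).[b] - (primitive r).[a].
Proof. by move=> ab; rewrite -Rintegral_deriv// deriv_primitive. Qed.

End BivariatePolynomials.

(** * Triangles *)

Section Triangles.
Variable R : realType.
Implicit Types (a b c x : R * R) (p : {poly {poly R}}).
Local Notation mu := (@lebesgue_measure R).
Local Notation mu2 := (@lebesgue2 R).

(** Twice the signed area of the triangle, positive when the vertices run counterclockwise. *)
Definition cross a b c : R :=
  (b.1 - a.1) * (c.2 - a.2) - (b.2 - a.2) * (c.1 - a.1).

Lemma cross_rot a b c : cross b c a = cross a b c.
Proof. rewrite /cross; ring. Qed.

Lemma cross_swap a b c : cross b a c = - cross a b c.
Proof. rewrite /cross; ring. Qed.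

(* Barycentric coordinates without division: those of [x] are [cross b c x],
   [cross c a x] and [cross a b x], each divided by [cross a b c]. *)
Definition tri a b c : set (R * R) :=
  [set x | [/\ 0 <= cross a b c * cross a b x, 0 <= cross a b c * cross b c x
            & 0 <= cross a b c * cross c a x]].

Lemma tri_rot a b c : tri b c a = tri a b c.
Proof. by rewrite /tri cross_rot; apply/seteqP; split=> x [A B C]; split. Qed.

(** Both factors of each product change sign, and the last two conditions trade places. *)
Lemma tri_swap a b c : tri b a c = tri a b c.
Proof.
have sub u v : tri v u c `<=` tri u v c.
  by move=> x [A B C]; split; [move: A|move: C|move: B]; rewrite /cross; lra.
by apply/seteqP; split; exact: sub.
Qed.

Lemma triP a b c x : cross a b c != 0 ->
  tri a b c x <-> exists la lb lc,
    [/\ 0 <= la, 0 <= lb, 0 <= lc, la + lb + lc = 1 &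
        x = (la * a.1 + lb * b.1 + lc * c.1, la * a.2 + lb * b.2 + lc * c.2)].
Proof.
move=> J0; split.
  move=> [A B C]; exists (cross b c x / cross a b c), (cross c a x / cross a b c),
    (cross a b x / cross a b c).
  (* Dividing by the square of the cross product passes from the sign of the product to that of the
     quotient. *)
  have pos u : 0 <= cross a b c * u -> 0 <= u / cross a b c.
    rewrite (_ : u / _ = cross a b c * u / cross a b c ^+ 2); last by field.
    by move=> ?; rewrite divr_ge0 ?sqr_ge0.
  split; [exact: pos|exact: pos|exact: pos| |].
    by move: J0; rewrite /cross => J0; field.
  case: x {A B C pos} => x y; congr pair; move: J0; rewrite /cross /= => J0; by field.
move=> [la [lb [lc [la0 lb0 lc0 s1 ->]]]].
have -> : la = 1 - lb - lc by lra.
have lae : 0 <= 1 - lb - lc by lra.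
split.
- rewrite [X in 0 <= X](_ : _ = lc * cross a b c ^+ 2).
    exact: (mulr_ge0 lc0 (sqr_ge0 _)).
  by rewrite /cross/=; ring.
- rewrite [X in 0 <= X](_ : _ = (1 - lb - lc) * cross a b c ^+ 2).
    exact: (mulr_ge0 lae (sqr_ge0 _)).
  by rewrite /cross/=; ring.
- rewrite [X in 0 <= X](_ : _ = lb * cross a b c ^+ 2).
    exact: (mulr_ge0 lb0 (sqr_ge0 _)).
  by rewrite /cross/=; ring.
Qed.

Lemma measurable_cross a b : measurable_fun setT (cross a b).
Proof.
apply: measurable_funB; apply: measurable_funM => //; exact: measurable_funB.
Qed.

Lemma measurable_tri a b c : measurable (tri a b c).
Proof.
have mh u v : measurable [set x | 0 <= cross a b c * cross u v x].
  rewrite (_ : [set _ | _] =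
    (fun x => cross a b c * cross u v x) @^-1` `[0, +oo[); last first.
    by apply/seteqP; split=> x /=; rewrite in_itv/= andbT.
  rewrite -[X in measurable X]setTI; apply: (measurable_funM _ (measurable_cross u v)) => //.
rewrite (_ : tri a b c = [set x | 0 <= cross a b c * cross a b x] `&`
  [set x | 0 <= cross a b c * cross b c x] `&`
  [set x | 0 <= cross a b c * cross c a x]).
  by apply: measurableI => //; exact: measurableI.
by apply/seteqP; split=> x [] => [A B C|[A B] C].
Qed.

Lemma tri_sub_box a b c : cross a b c != 0 ->
  exists m : R, tri a b c `<=` `[- m, m] `*` `[- m, m].
Proof.
move=> J0; exists (`|a.1| + `|b.1| + `|c.1| + (`|a.2| + `|b.2| + `|c.2|)).
have bnd (la lb lc u v w m : R) : 0 <= la -> 0 <= lb -> 0 <= lc ->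
    la + lb + lc = 1 -> `|u| + `|v| + `|w| <= m ->
    la * u + lb * v + lc * w \in `[- m, m].
  move=> la0 lb0 lc0 s1 um; rewrite in_itv /= -ler_norml.
  apply: le_trans um; apply: le_trans (ler_normD _ _) _; apply: lerD.
    apply: le_trans (ler_normD _ _) _; apply: lerD; rewrite normrM ler_piMl//;
    rewrite ger0_norm//; lra.
  rewrite normrM ler_piMl// ger0_norm//; lra.
move=> x /(triP _ J0)[la [lb [lc [la0 lb0 lc0 s1 ->]]]]; split; apply: bnd => //.
  by rewrite lerDl !addr_ge0.
by rewrite lerDr !addr_ge0.
Qed.

Lemma mu2_box (m : R) : (mu2 (`[(- m)%R, m] `*` `[(- m)%R, m]) < +oo)%E.
Proof.
have fin : (mu `[(- m)%R, m] < +oo)%E.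
  by rewrite lebesgue_measure_itv/=; case: ifP; rewrite ?ltry.
by rewrite /lebesgue2 product_measure1E//; apply: lte_mul_pinfty; rewrite ?ge0_fin_numE.
Qed.

(** The enclosing box serves twice: it has finite measure, and its compactness bounds the continuous
    function [peval p]. *)
Lemma integrable_peval a b c p : cross a b c != 0 ->
  mu2.-integrable (tri a b c) (EFin \o peval p).
Proof.
move=> J0; have [m sub] := tri_sub_box J0.
apply: measurable_bounded_integrable.
- exact: measurable_tri.
- apply: le_lt_trans (mu2_box m); apply: le_measure => //; rewrite inE.
    exact: measurable_tri.
  exact: measurableX.
- by apply: measurable_funTS; exact: measurable_peval.
- have : compact (peval p @` (`[- m, m] `*` `[- m, m])).
    apply: continuous_compact; first exact: (continuous_subspaceT (@continuous_peval R p)).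
    by apply: compact_setX; exact: segment_compact.
  move=> /compact_bounded[M [Mr hM]]; exists M; split=> // N MN x /sub xb.
  by apply: (hM N MN); exists x.
Qed.

End Triangles.

(** * Green's formula on a triangle *)

Section Green.
Variable R : realType.
Implicit Types (a b c x : R * R) (p : {poly {poly R}}) (t u v J : R).
Local Notation mu := (@lebesgue_measure R).
Local Notation mu2 := (@lebesgue2 R).

Definition seg_trace p a b : {poly R} :=
  trace p (a.1%:P + (b.1 - a.1) *: 'X) (a.2%:P + (b.2 - a.2) *: 'X).

Lemma horner_seg_trace p a b t :
  (seg_trace p a b).[t] = peval p (seg_pt a b t).
Proof. by rewrite horner_trace !hornerE /seg_pt ![t * _]mulrC. Qed.

(** The segment parametrised by abscissa, to match vertical slices. On a vertical edge the slope
    takes the default value 0, and the range of integration is a single point. *)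
Definition graph_trace p a b : {poly R} :=
  trace p 'X (a.2%:P + ((b.2 - a.2) / (b.1 - a.1)) *: ('X - a.1%:P)).

Definition height a b t : R := a.2 + (b.2 - a.2) / (b.1 - a.1) * (t - a.1).

Lemma horner_graph_trace p a b t :
  (graph_trace p a b).[t] = peval p (t, height a b t).
Proof. by rewrite horner_trace !hornerE. Qed.

Lemma Rintegral_graph_trace p a b : a.1 < b.1 ->
  \int[mu]_(t in `[a.1, b.1]) (graph_trace p a b).[t] =
  (b.1 - a.1) * \int[mu]_(t in `[0, 1]) peval p (seg_pt a b t).
Proof.
move=> ab; have ab0 : b.1 - a.1 != 0 by rewrite subr_eq0 gt_eqF.
pose Q := primitive (graph_trace p a b).
(* The change of variables is made on primitives: [Q] composed with the affine parametrisation of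
   the abscissa, rescaled by its slope. *)
pose S := (b.1 - a.1)^-1 *: (Q \Po (a.1%:P + (b.1 - a.1) *: 'X)).
have S' t : S^`().[t] = peval p (seg_pt a b t).
  rewrite /S derivZ deriv_comp deriv_primitive derivD derivC add0r derivZ derivX.
  rewrite alg_polyC mulrC mul_polyC scalerA mulVf// scale1r horner_comp.
  rewrite horner_graph_trace !hornerE /=.
  by rewrite /height /seg_pt; congr (peval _ (_, _)); [rewrite mulrC|field].
under [in RHS]eq_Rintegral do rewrite -S'.
rewrite Rintegral_deriv//.
rewrite Rintegral_horner ?ltW// /S !hornerE !horner_comp !hornerE -/Q.
by rewrite /= -mulrBr mulVKf// [a.1 + _]addrC addrK.
Qed.

Lemma Rintegral_seg_sym p a b :
  \int[mu]_(t in `[0, 1]) peval p (seg_pt b a t) =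
  \int[mu]_(t in `[0, 1]) peval p (seg_pt a b t).
Proof.
pose Q := primitive (seg_trace p a b).
(* Reversing the segment is the substitution of [1 - t] for [t], again made on the primitive. *)
have S' t : (- (Q \Po (1 - 'X)))^`().[t] = peval p (seg_pt b a t).
  rewrite derivN deriv_comp deriv_primitive derivB derivC derivX sub0r mulrN1 opprK.
  rewrite horner_comp !hornerE horner_seg_trace /seg_pt /=; congr (peval _ (_, _)); ring.
under eq_Rintegral do rewrite -S'.
under [in RHS]eq_Rintegral do rewrite -horner_seg_trace.
rewrite Rintegral_deriv// Rintegral_horner// !hornerE !horner_comp !hornerE subrr subr0 /= -/Q; ring.
Qed.

(* The line integral of [- p dx] along the segment from [a] to [b]. *)
Definition line_dx p a b : R :=
  (a.1 - b.1) * \int[mu]_(t in `[0, 1]) peval p (seg_pt a b t).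

Lemma line_dx_sym p a b : line_dx p b a = - line_dx p a b.
Proof. by rewrite /line_dx Rintegral_seg_sym -mulNr opprB. Qed.

Lemma Rintegral_graph_line p a b : a.1 <= b.1 ->
  \int[mu]_(t in `[a.1, b.1]) (graph_trace p a b).[t] = - line_dx p a b.
Proof.
rewrite le_eqVlt => /predU1P[ab|ab].
  by rewrite /line_dx -ab set_itv1 Rintegral_set1 subrr mul0r oppr0.
by rewrite Rintegral_graph_trace// /line_dx -mulNr opprB.
Qed.

(** [J] stands for the cross product of the vertices: its sign tells which of the heights [u] and
    [v] is the lower end of the slice, and [Num.sg J] restores the orientation. *)
Lemma integral_dY_slice p t J u v : J != 0 -> 0 <= J * (v - u) ->
  (\int[mu]_(y in [set y | (0 <= J * (y - u))%R /\ (J * (y - v) <= 0)%R])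
     (peval (dY p) (t, y))%:E)%E
  = (Num.sg J * (peval p (t, v) - peval p (t, u)))%:E.
Proof.
have E y : peval (dY p) (t, y) = (p.[t%:P])^`().[y] by rewrite dYE.
move=> J0 Juv; under eq_integral do rewrite E.
have [Jn|Jp|J00] := ltgtP J 0; last by rewrite J00 eqxx in J0.
  rewrite (_ : [set _ | _] = `[v, u]%classic).
    rewrite integral_deriv; last by rewrite -subr_le0 -(nmulr_rge0 _ Jn).
    by rewrite ltr0_sg// mulN1r opprB.
  apply/seteqP; split => y /=; rewrite in_itv/= nmulr_rge0// nmulr_rle0//.
    by rewrite subr_le0 subr_ge0 => -[-> ->].
  by rewrite subr_le0 subr_ge0 => /andP[-> ->].
rewrite (_ : [set _ | _] = `[u, v]%classic).
  rewrite integral_deriv; last by rewrite -subr_ge0 -(pmulr_rge0 _ Jp).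
  by rewrite gtr0_sg// mul1r.
apply/seteqP; split => y /=; rewrite in_itv/= pmulr_rge0// pmulr_rle0//.
  by rewrite subr_le0 subr_ge0 => -[-> ->].
by rewrite subr_le0 subr_ge0 => /andP[-> ->].
Qed.

End Green.

(** * Slices of a triangle, Fubini and reflection in the diagonal *)

Section GreenTriangle.
Variable R : realType.
Implicit Types (a b c x : R * R) (p : {poly {poly R}}) (t u v J : R).
Local Notation mu := (@lebesgue_measure R).
Local Notation mu2 := (@lebesgue2 R).

Lemma cross_height a b t (y : R) : a.1 != b.1 ->
  cross a b (t, y) = (b.1 - a.1) * (y - height a b t).
Proof.
move=> ab; have ab0 : b.1 - a.1 != 0 by rewrite subr_eq0 eq_sym.
by rewrite /cross /height /=; field.
Qed.

Lemma cross_heightN a b t (y : R) : a.1 != b.1 ->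
  cross b a (t, y) = - (b.1 - a.1) * (y - height a b t).
Proof.
move=> ab; have ab0 : b.1 - a.1 != 0 by rewrite subr_eq0 eq_sym.
by rewrite /cross /height /=; field.
Qed.

(** Left of the middle vertex the slice is bounded by the edges [ab] and [ac]; the condition of [bc]
    follows from that of [ab]. *)
Lemma slice_left a b c t : cross a b c != 0 -> b.1 <= c.1 ->
  a.1 < t -> t < b.1 ->
  [set y | tri a b c (t, y)] =
  [set y | 0 <= cross a b c * (y - height a b t) /\
           cross a b c * (y - height a c t) <= 0].
Proof.
move=> J0 bc at_ tb; have ab := lt_trans at_ tb; have ac := lt_le_trans ab bc.
have ab0 : 0 < b.1 - a.1 by rewrite subr_gt0.
have ac0 : 0 < c.1 - a.1 by rewrite subr_gt0.
have Eab y : cross a b c * cross a b (t, y) =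
    (b.1 - a.1) * (cross a b c * (y - height a b t)).
  by rewrite cross_height ?lt_eqF// mulrCA.
have Eca y : cross a b c * cross c a (t, y) =
    - ((c.1 - a.1) * (cross a b c * (y - height a c t))).
  by rewrite cross_heightN ?lt_eqF// mulNr mulrN mulrCA.
apply/seteqP; split=> y /=.
  move=> [A _ C]; move: A C; rewrite Eab Eca oppr_ge0.
  by rewrite (pmulr_rge0 _ ab0) (pmulr_rle0 _ ac0).
move=> [A C]; have A' : 0 <= cross a b c * cross a b (t, y).
  by rewrite Eab mulr_ge0// ltW.
split => //; last by rewrite Eca oppr_ge0 (pmulr_rle0 _ ac0).
(* Scaled by [b.1 - a.1], the condition of [bc] is a square times [b.1 - t] plus the condition of
   [ab] times [c.1 - b.1]. *)
rewrite -(pmulr_rge0 _ ab0).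
rewrite [leRHS](_ : _ = cross a b c ^+ 2 * (b.1 - t)
  + cross a b c * cross a b (t, y) * (c.1 - b.1)); last by rewrite /cross/=; ring.
by rewrite addr_ge0// mulr_ge0// ?sqr_ge0// subr_ge0// ltW.
Qed.

(** Mirror image of [slice_left]: right of the middle vertex the condition of [ab] follows from that
    of [bc]. *)
Lemma slice_right a b c t : cross a b c != 0 -> a.1 <= b.1 ->
  b.1 < t -> t < c.1 ->
  [set y | tri a b c (t, y)] =
  [set y | 0 <= cross a b c * (y - height b c t) /\
           cross a b c * (y - height a c t) <= 0].
Proof.
move=> J0 ab bt tc; have bc := lt_trans bt tc; have ac := le_lt_trans ab bc.
have bc0 : 0 < c.1 - b.1 by rewrite subr_gt0.
have ac0 : 0 < c.1 - a.1 by rewrite subr_gt0.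
have Ebc y : cross a b c * cross b c (t, y) =
    (c.1 - b.1) * (cross a b c * (y - height b c t)).
  by rewrite cross_height ?lt_eqF// mulrCA.
have Eca y : cross a b c * cross c a (t, y) =
    - ((c.1 - a.1) * (cross a b c * (y - height a c t))).
  by rewrite cross_heightN ?lt_eqF// mulNr mulrN mulrCA.
apply/seteqP; split=> y /=.
  move=> [_ A C]; move: A C; rewrite Ebc Eca oppr_ge0.
  by rewrite (pmulr_rge0 _ bc0) (pmulr_rle0 _ ac0).
move=> [A C]; have A' : 0 <= cross a b c * cross b c (t, y).
  by rewrite Ebc mulr_ge0// ltW.
split => //; last by rewrite Eca oppr_ge0 (pmulr_rle0 _ ac0).
rewrite -(pmulr_rge0 _ bc0).
rewrite [leRHS](_ : _ = cross a b c ^+ 2 * (t - b.1)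
  + cross a b c * cross b c (t, y) * (b.1 - a.1)); last by rewrite /cross/=; ring.
by rewrite addr_ge0// mulr_ge0// ?sqr_ge0// subr_ge0// ltW.
Qed.

(** The gap between the two edges grows linearly from [a]; times the cross product it is a square
    times positive factors. *)
Lemma height_left a b c t : b.1 <= c.1 -> a.1 < t -> t < b.1 ->
  0 <= cross a b c * (height a c t - height a b t).
Proof.
move=> bc at_ tb; have ab := lt_trans at_ tb; have ac := lt_le_trans ab bc.
have ab0 : 0 < b.1 - a.1 by rewrite subr_gt0.
have ac0 : 0 < c.1 - a.1 by rewrite subr_gt0.
rewrite [leRHS](_ : _ = cross a b c ^+ 2 * (t - a.1) / ((b.1 - a.1) * (c.1 - a.1))).
  by apply: divr_ge0; apply: mulr_ge0; rewrite ?sqr_ge0 ?subr_ge0// ltW.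
by rewrite /height /cross; field; rewrite !gt_eqF.
Qed.

Lemma height_right a b c t : a.1 <= b.1 -> b.1 < t -> t < c.1 ->
  0 <= cross a b c * (height a c t - height b c t).
Proof.
move=> ab bt tc; have bc := lt_trans bt tc; have ac := le_lt_trans ab bc.
have bc0 : 0 < c.1 - b.1 by rewrite subr_gt0.
have ac0 : 0 < c.1 - a.1 by rewrite subr_gt0.
rewrite [leRHS](_ : _ = cross a b c ^+ 2 * (c.1 - t) / ((c.1 - b.1) * (c.1 - a.1))).
  by apply: divr_ge0; apply: mulr_ge0; rewrite ?sqr_ge0 ?subr_ge0// ltW.
by rewrite /height /cross; field; rewrite !gt_eqF.
Qed.

Lemma slice_out a b c t : cross a b c != 0 -> a.1 <= b.1 -> b.1 <= c.1 ->
  t \notin `[a.1, c.1] -> [set y | tri a b c (t, y)] = set0.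
Proof.
move=> J0 ab bc; rewrite in_itv /= => tac; apply/seteqP; split => // y /=.
move=> /(triP _ J0)[la [lb [lc [la0 lb0 lc0 s1 [te _]]]]].
move/negP : tac; apply; rewrite te; apply/andP; split; nra.
Qed.

Lemma integrable_peval_patch a b c p : cross a b c != 0 ->
  mu2.-integrable setT ((EFin \o peval p) \_ (tri a b c)).
Proof.
move=> J0; apply: (iffLR (integrable_mkcond _ _)).
  exact: measurable_tri.
exact: integrable_peval.
Qed.

Lemma integral_tri_fubini a b c p : cross a b c != 0 ->
  (\int[mu2]_(x in tri a b c) (peval p x)%:E =
   \int[mu]_t \int[mu]_(y in [set y | tri a b c (t, y)]) (peval p (t, y))%:E)%E.
Proof.
move=> J0; have ip := integrable_peval_patch p J0.
rewrite integral_mkcond -integral12_prod_meas1//; apply: eq_integral => t _.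
rewrite [RHS]integral_mkcond; apply: eq_integral => y _.
by rewrite /patch; congr (if _ then _ else _); apply/idP/idP; rewrite !inE.
Qed.

Lemma integral_tri_fubini2 a b c p : cross a b c != 0 ->
  (\int[mu2]_(x in tri a b c) (peval p x)%:E =
   \int[mu]_t \int[mu]_(y in [set y | tri a b c (y, t)]) (peval p (y, t))%:E)%E.
Proof.
move=> J0; have ip := integrable_peval_patch p J0.
rewrite integral_mkcond -integral21_prod_meas1//; apply: eq_integral => t _.
rewrite [RHS]integral_mkcond; apply: eq_integral => y _.
by rewrite /patch; congr (if _ then _ else _); apply/idP/idP; rewrite !inE.
Qed.

Definition swap x : R * R := (x.2, x.1).

Lemma cross_swap_coord a b c : cross (swap a) (swap b) (swap c) = - cross a b c.
Proof. by rewrite /cross /swap /=; ring. Qed.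

(** Fubini in both orders replaces a change of variables: vertical slices of the triangle are
    horizontal slices of its reflection. *)
Lemma integral_tri_swap a b c p : cross a b c != 0 ->
  (\int[mu2]_(x in tri a b c) (peval p x)%:E =
   \int[mu2]_(x in tri (swap a) (swap b) (swap c)) (peval (swapXY p) x)%:E)%E.
Proof.
move=> J0; rewrite integral_tri_fubini//.
rewrite integral_tri_fubini2 ?cross_swap_coord ?oppr_eq0//.
apply: eq_integral => t _.
rewrite (_ : [set y | tri a b c _] =
             [set y | tri (swap a) (swap b) (swap c) (y, t)]).
  by apply: eq_integral => y _; rewrite peval_swap.
(* The reflection reverses orientation, so both factors of each condition change sign. *)
have sw (u v : R * R) y : cross (swap u) (swap v) (y, t) = - cross u v (t, y).
  exact: (cross_swap_coord u v (t, y)).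
by apply/seteqP; split=> y [A B C]; move: A B C;
  rewrite /tri /= !sw cross_swap_coord !mulrNN.
Qed.

End GreenTriangle.

(** * Green's formula for sorted vertices, then for any order *)

Section GreenFormula.
Variable R : realType.
Implicit Types (a b c x : R * R) (p : {poly {poly R}}) (r : {poly R}) (t u v : R).
Local Notation mu := (@lebesgue_measure R).
Local Notation mu2 := (@lebesgue2 R).

Lemma EFin_Rintegral_horner r u v :
  (\int[mu]_(t in `[u, v]) r.[t]%:E)%E = (\int[mu]_(t in `[u, v]) r.[t])%:E.
Proof.
rewrite /Rintegral fineK//; apply: integrable_fin_num => //.
exact: integrable_horner.
Qed.

(** Endpoints are negligible, so a formula for [G] strictly between them suffices; the slice lemmas
    say nothing at the abscissas of the vertices. *)
Lemma integral_horner_oo (G : R -> \bar R) r u v (b0 b1 : bool) :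
  measurable_fun setT G -> (forall t, u < t -> t < v -> G t = (r.[t])%:E) ->
  (\int[mu]_(t in [set` Interval (BSide b0 u) (BSide b1 v)]) G t)%E
  = (\int[mu]_(t in `[u, v]) r.[t])%:E.
Proof.
move=> mG Gr; rewrite integral_itv_bndoo; last exact: measurable_funTS.
rewrite -EFin_Rintegral_horner [RHS]integral_itv_bndoo; last first.
  by apply/measurable_EFinP; apply: measurable_funTS; exact: measurable_horner.
apply: eq_integral => t; rewrite inE /= in_itv /= => /andP[ut tv].
exact: Gr.
Qed.

Lemma measurable_slice_integral a b c p : cross a b c != 0 ->
  measurable_fun setT (fun t =>
    (\int[mu]_(y in [set y | tri a b c (t, y)]) (peval p (t, y))%:E)%E).
Proof.
move=> J0; have ip := integrable_peval_patch p J0.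
have := measurable_fubini_F ip; apply: eq_measurable_fun => t _.
rewrite /fubini_F [RHS]integral_mkcond; apply: eq_integral => y _.
by rewrite /patch; congr (if _ then _ else _); apply/idP/idP; rewrite !inE.
Qed.

Lemma integral_tri_dY_sorted a b c p :
  cross a b c != 0 -> a.1 <= b.1 -> b.1 <= c.1 ->
  (\int[mu2]_(x in tri a b c) (peval (dY p) x)%:E)%E =
  (Num.sg (cross a b c) * (line_dx p a b + line_dx p b c + line_dx p c a))%:E.
Proof.
move=> J0 ab bc; rewrite integral_tri_fubini//.
have := measurable_slice_integral (dY p) J0.
set G := fun t : R => (\int[mu]_(y in _) _)%E => mG.
(* Slices outside the range of abscissas are empty. The remaining interval is then cut at the middle
   vertex, where the edge facing [ac] changes. *)
transitivity (\int[mu]_(t in `[a.1, c.1]) G t)%E.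
  rewrite [RHS]integral_mkcond; apply: eq_integral => t _; rewrite /patch.
  case: ifPn => //; rewrite notin_setE /= => /negP tac.
  by rewrite (slice_out J0 ab bc tac) integral_set0.
rewrite (@itv_bndbnd_setU _ _ _ (BLeft b.1)); [|by rewrite bnd_simp..].
rewrite integral_setU//=; first last.
- apply/disj_setPS => t [/=]; rewrite !in_itv/= => /andP[_ tb] /andP[].
  by rewrite leNgt tb.
- exact: measurable_funTS.
pose s := Num.sg (cross a b c).
rewrite (@integral_horner_oo _ (s%:P * (graph_trace p a c - graph_trace p a b)))//; last first.
  move=> t at_ tb; rewrite /G (slice_left J0 bc at_ tb).
  rewrite integral_dY_slice ?height_left// !hornerE.
  by rewrite !horner_graph_trace.
rewrite (@integral_horner_oo _ (s%:P * (graph_trace p a c - graph_trace p b c)))//; last first.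
  move=> t bt tc; rewrite /G (slice_right J0 ab bt tc).
  rewrite integral_dY_slice ?height_right// !hornerE.
  by rewrite !horner_graph_trace.
have split_ q q' u v : \int[mu]_(t in `[u, v]) (s%:P * (q - q')).[t] =
    s * (\int[mu]_(t in `[u, v]) q.[t] - \int[mu]_(t in `[u, v]) q'.[t]).
  under eq_Rintegral do rewrite hornerM hornerC.
  rewrite RintegralZl//; last exact: integrable_horner.
  under eq_Rintegral do rewrite hornerD hornerN.
  by rewrite RintegralB//; exact: integrable_horner.
rewrite !split_ -EFinD -mulrDr; congr (_ * _)%:E.
(* The long edge [ac] bounds the slices on both halves; its two contributions join into one line
   integral. *)
have glue : \int[mu]_(t in `[a.1, b.1]) (graph_trace p a c).[t] +
    \int[mu]_(t in `[b.1, c.1]) (graph_trace p a c).[t] = - line_dx p a c.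
  rewrite -Rintegral_graph_line ?(le_trans ab)//.
  rewrite !Rintegral_horner ?(le_trans ab)//; ring.
rewrite addrACA glue !Rintegral_graph_line// (line_dx_sym p a c); ring.
Qed.

Lemma integral_tri_dY a b c p : cross a b c != 0 ->
  (\int[mu2]_(x in tri a b c) (peval (dY p) x)%:E)%E =
  (Num.sg (cross a b c) * (line_dx p a b + line_dx p b c + line_dx p c a))%:E.
Proof.
pose P (u v w : R * R) := cross u v w != 0 ->
  (\int[mu2]_(x in tri u v w) (peval (dY p) x)%:E)%E =
  (Num.sg (cross u v w) * (line_dx p u v + line_dx p v w + line_dx p w u))%:E.
have rot (u v w : R * R) : P u v w -> P v w u.
  rewrite /P (cross_rot u v w) (tri_rot u v w) => + J0 => ->//; congr (_ * _)%:E; ring.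
(* A swap negates both the sign of the cross product and, by reversing each edge, the boundary
   sum. *)
have sw (u v w : R * R) : P u v w -> P v u w.
  rewrite /P (cross_swap u v w) oppr_eq0 tri_swap => + J0 => ->//.
  by rewrite sgrN (line_dx_sym p u v) (line_dx_sym p w u) (line_dx_sym p v w); congr _%:E; ring.
have sorted (u v w : R * R) : u.1 <= v.1 -> v.1 <= w.1 -> P u v w.
  by move=> uv vw J0; exact: integral_tri_dY_sorted.
suff : P a b c by [].
(* Each of the six orders of the abscissas is brought to the sorted one by rotations and a swap. *)
have [ab|/ltW ba] := leP a.1 b.1; have [bc|/ltW cb] := leP b.1 c.1.
- exact: sorted.
- have [ac|/ltW ca] := leP a.1 c.1.
    by apply: (rot c a b); apply: sw; exact: sorted.
  by apply: (rot c a b); exact: sorted.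
- have [ac|/ltW ca] := leP a.1 c.1.
    by apply: sw; exact: sorted.
  by apply: (rot c a b); apply: (rot b c a); exact: sorted.
- by apply: (rot c a b); apply: (rot b c a); apply: sw; exact: sorted.
Qed.

End GreenFormula.

(** * The divergence theorem with outward normals *)

Section Divergence.
Variable R : realType.
Implicit Types (a b c x : R * R) (p : {poly {poly R}}) (r : {poly R}) (t u v : R).
Local Notation mu := (@lebesgue_measure R).
Local Notation mu2 := (@lebesgue2 R).

(** The line integral of [p dy] along the segment from [a] to [b], counterpart of [line_dx]. *)
Definition line_dy p a b : R :=
  (b.2 - a.2) * \int[mu]_(t in `[0, 1]) peval p (seg_pt a b t).

(** Reflection of [integral_tri_dY]: the reversed orientation cancels the opposite sign conventions
    of [line_dx] and [line_dy]. *)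
Lemma integral_tri_dX a b c p : cross a b c != 0 ->
  (\int[mu2]_(x in tri a b c) (peval (dX p) x)%:E)%E =
  (Num.sg (cross a b c) * (line_dy p a b + line_dy p b c + line_dy p c a))%:E.
Proof.
move=> J0; rewrite integral_tri_swap// swapXY_dX.
rewrite integral_tri_dY ?cross_swap_coord ?oppr_eq0// sgrN; congr _%:E.
have E (u v : R * R) : line_dx (swapXY p) (swap u) (swap v) = - line_dy p u v.
  rewrite /line_dx /line_dy -mulNr opprB; congr (_ * _).
  by apply: eq_Rintegral => t _; rewrite [RHS]peval_swap.
by rewrite !E; ring.
Qed.

Lemma segment_integral_pevalZ a b p (k : R) :
  segment_integral a b (fun x => peval p x * k) =
  dist2 a b * k * \int[mu]_(t in `[0, 1]) peval p (seg_pt a b t).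
Proof.
rewrite /segment_integral; under eq_Rintegral do rewrite -horner_seg_trace.
rewrite RintegralZr//; last exact: integrable_horner.
under [in RHS]eq_Rintegral do rewrite -horner_seg_trace.
by rewrite -mulrA [k * _]mulrC.
Qed.

Lemma dist2_neq0 a b c : cross a b c != 0 -> dist2 a b != 0.
Proof.
apply: contra; rewrite /dist2 sqrtr_eq0 => ab.
have [A B] : (b.1 - a.1) ^+ 2 = 0 /\ (b.2 - a.2) ^+ 2 = 0.
  have := sqr_ge0 (b.1 - a.1); have := sqr_ge0 (b.2 - a.2); split; lra.
move/eqP: A; rewrite sqrf_eq0 => /eqP A; move/eqP: B; rewrite sqrf_eq0 => /eqP B.
by rewrite /cross A B !mul0r subrr.
Qed.

Variables (T : finType) (vtx : T -> 'I_3 -> R * R) (K : T).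
Hypothesis Knd : Defs.nondegenerate vtx K.
Local Notation v0 := (vtx K 0).
Local Notation v1 := (vtx K 1).
Local Notation v2 := (vtx K 2%:R).

Lemma crossK : cross v0 v1 v2 != 0.
Proof. exact: Knd. Qed.

Lemma edge_verticesE :
  [/\ e_src vtx K 0 = v1, e_tgt vtx K 0 = v2, e_src vtx K 1 = v2,
      e_tgt vtx K 1 = v0 & e_src vtx K 2%:R = v0 /\ e_tgt vtx K 2%:R = v1].
Proof.
by rewrite /e_src /e_tgt; split; [..|split]; congr (vtx K _); apply: val_inj.
Qed.

Lemma triangleE : triangle vtx K = tri v0 v1 v2.
Proof.
apply/seteqP; split => x.
  move=> [l [l0 l1 ->]]; apply/(triP _ crossK).
  exists (l 0), (l 1), (l 2%:R); move: l1; rewrite !big_ord_recl !big_ord0 !addr0.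
  have -> : lift ord0 ord0 = 1 :> 'I_3 by apply: val_inj.
  have -> : lift ord0 (lift ord0 ord0) = 2%:R :> 'I_3 by apply: val_inj.
  by rewrite !addrA => l1; split.
move=> /(triP _ crossK)[la [lb [lc [la0 lb0 lc0 s1 ->]]]].
exists (fun i : 'I_3 => [:: la; lb; lc]`_i); split.
- by case=> -[|[|[|]]].
- by rewrite !big_ord_recl big_ord0 /= addr0 addrA.
- rewrite !big_ord_recl !big_ord0 /= !addr0 !addrA.
  have -> : lift ord0 ord0 = 1 :> 'I_3 by apply: val_inj.
  by have -> : lift ord0 (lift ord0 ord0) = 2%:R :> 'I_3 by apply: val_inj.
Qed.

(** The sign that points away from the opposite vertex is the orientation of the triangle, the same
    sign as in Green's formula. *)
Lemma normalE i : (cross (e_src vtx K i) (e_tgt vtx K i) (vtx K i) = cross v0 v1 v2) ->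
  normal vtx K i =
  (Num.sg (cross v0 v1 v2) * ((e_tgt vtx K i).2 - (e_src vtx K i).2) /
     dist2 (e_src vtx K i) (e_tgt vtx K i),
   Num.sg (cross v0 v1 v2) * ((e_src vtx K i).1 - (e_tgt vtx K i).1) /
     dist2 (e_src vtx K i) (e_tgt vtx K i)).
Proof.
move=> <-; rewrite /normal; set s := - Num.sg _.
have -> : s = Num.sg (cross (e_src vtx K i) (e_tgt vtx K i) (vtx K i)) => //.
by rewrite /s -sgrN; congr Num.sg; rewrite /cross; ring.
Qed.

Lemma cross_edge i : cross (e_src vtx K i) (e_tgt vtx K i) (vtx K i) = cross v0 v1 v2.
Proof.
have [s0 t0 s1 t1 [s2 t2]] := edge_verticesE.
case: i => -[|[|[|//]]] i3.
- rewrite (_ : Ordinal i3 = 0) ?s0 ?t0; last exact: val_inj.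
  exact: cross_rot.
- rewrite (_ : Ordinal i3 = 1) ?s1 ?t1; last exact: val_inj.
  by rewrite (cross_rot v1 v2 v0) (cross_rot v0 v1 v2).
- by rewrite (_ : Ordinal i3 = 2%:R) ?s2 ?t2; last exact: val_inj.
Qed.

Lemma dist2_edge i : dist2 (e_src vtx K i) (e_tgt vtx K i) != 0.
Proof. by apply: (@dist2_neq0 _ _ (vtx K i)); rewrite cross_edge crossK. Qed.

Lemma sum_edges (f : R * R -> R * R -> R) :
  \sum_(i < 3) f (e_src vtx K i) (e_tgt vtx K i) = f v0 v1 + f v1 v2 + f v2 v0.
Proof.
have [s0 t0 s1 t1 [s2 t2]] := edge_verticesE.
rewrite !big_ord_recl big_ord0 addr0.
have -> : lift ord0 ord0 = 1 :> 'I_3 by apply: val_inj.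
have -> : lift ord0 (lift ord0 ord0) = 2%:R :> 'I_3 by apply: val_inj.
by rewrite s0 t0 s1 t1 s2 t2 addrA addrC addrA.
Qed.

(** The edge length in the arc-length integral cancels the one that normalises the normal, leaving
    [line_dy] up to the orientation sign. *)
Lemma divergence_dX p :
  \int[mu2]_(x in triangle vtx K) peval (dX p) x =
  \sum_(i < 3) segment_integral (e_src vtx K i) (e_tgt vtx K i)
    (fun x => peval p x * (normal vtx K i).1).
Proof.
rewrite triangleE /Rintegral integral_tri_dX ?crossK//= -sum_edges mulr_sumr.
apply: eq_bigr => i _.
rewrite (segment_integral_pevalZ _ _ _ (normal vtx K i).1) normalE ?cross_edge//=.
by rewrite [dist2 _ _ * _]mulrC divfK ?dist2_edge// mulrA.
Qed.

Lemma divergence_dY p :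
  \int[mu2]_(x in triangle vtx K) peval (dY p) x =
  \sum_(i < 3) segment_integral (e_src vtx K i) (e_tgt vtx K i)
    (fun x => peval p x * (normal vtx K i).2).
Proof.
rewrite triangleE /Rintegral integral_tri_dY ?crossK//= -sum_edges mulr_sumr.
apply: eq_bigr => i _.
rewrite (segment_integral_pevalZ _ _ _ (normal vtx K i).2) normalE ?cross_edge//=.
by rewrite [dist2 _ _ * _]mulrC divfK ?dist2_edge// mulrA.
Qed.

End Divergence.

(** * Definiteness of the L2 product *)

Section Definiteness.
Variable R : realType.
Implicit Types (a b c x : R * R) (p : {poly {poly R}}) (e t : R).
Local Notation mu := (@lebesgue_measure R).
Local Notation mu2 := (@lebesgue2 R).

(** Green's formula for the polynomial [y], encoded as ['X%:P], whose derivative [dY] is 1. *)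
Lemma area_tri a b c : cross a b c != 0 ->
  mu2 (tri a b c) = (`|cross a b c| / 2)%:E.
Proof.
move=> J0; rewrite -[LHS]mul1e -integral_cst; last exact: measurable_tri.
have dY1 x : 1 = peval (dY 'X%:P) x.
  by rewrite /dY map_polyC /= derivX pevalC.
transitivity (\int[mu2]_(x in tri a b c) (peval (dY 'X%:P) x)%:E)%E.
  by apply: eq_integral => x _; rewrite -dY1.
rewrite integral_tri_dY// [X in _ = (X / _)%:E]normrEsg -mulrA; congr (_ * _)%:E.
(* The ordinate is affine along an edge, so its mean is the value at the midpoint. *)
have mid (u v : R * R) : \int[mu]_(t in `[0, 1]) peval 'X%:P (seg_pt u v t) = (u.2 + v.2) / 2.
  pose S := u.2 *: 'X + ((v.2 - u.2) / 2) *: 'X^2.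
  have S' t : peval 'X%:P (seg_pt u v t) = S^`().[t].
    rewrite /peval /seg_pt hornerC hornerX /= derivD !derivZ derivX derivXn /=.
    by rewrite !hornerE /=; field.
  under eq_Rintegral do rewrite S'.
  by rewrite Rintegral_deriv// /S !hornerE /=; field.
by rewrite /line_dx !mid /cross; field.
Qed.

(** The homothety of centre [x] and ratio [e]. *)
Definition dilate x e a : R * R := (x.1 + e * (a.1 - x.1), x.2 + e * (a.2 - x.2)).

Lemma cross_dilate x e a b c :
  cross (dilate x e a) (dilate x e b) (dilate x e c) = e ^+ 2 * cross a b c.
Proof. by rewrite /cross /dilate /=; ring. Qed.

Lemma dilate_tri x e a b c z : cross a b c != 0 -> 0 < e ->
  tri (dilate x e a) (dilate x e b) (dilate x e c) z ->
  exists2 y, tri a b c y & z = dilate x e y.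
Proof.
move=> J0 e0; have JK : cross (dilate x e a) (dilate x e b) (dilate x e c) != 0.
  by rewrite cross_dilate mulf_neq0// expf_neq0// gt_eqF.
move=> /(triP _ JK) [la [lb [lc [la0 lb0 lc0 s1 ->]]]].
exists (la * a.1 + lb * b.1 + lc * c.1, la * a.2 + lb * b.2 + lc * c.2).
  by apply/(triP _ J0); exists la, lb, lc.
have -> : la = 1 - lb - lc by lra.
by rewrite /dilate /=; congr pair; ring.
Qed.

Lemma tri_convex x e a b c y : cross a b c != 0 -> 0 <= e <= 1 ->
  tri a b c x -> tri a b c y -> tri a b c (dilate x e y).
Proof.
move=> J0 /andP[e0 e1].
have conv (u v : R * R) (k : R) : 0 <= k * cross u v x -> 0 <= k * cross u v y ->
    0 <= k * cross u v (dilate x e y).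
  move=> kx ky; rewrite [leRHS](_ : _ = (1 - e) * (k * cross u v x) + e * (k * cross u v y)).
    by rewrite addr_ge0// mulr_ge0// subr_ge0.
  by rewrite /cross /dilate /=; ring.
by move=> [A B C] [A' B' C']; split; apply: conv.
Qed.

(** If [p] were nonzero at [x], its square would exceed a positive constant near [x]. Shrinking the
    triangle towards [x] gives a set of positive area inside both that neighbourhood and the
    triangle, even when [x] lies on the boundary. *)
Lemma peval_square_eq0 a b c p x : cross a b c != 0 ->
  (\int[mu2]_(x in tri a b c) (peval (p * p) x)%:E = 0)%E ->
  tri a b c x -> peval p x = 0.
Proof.
move=> J0 I0 xt; apply/eqP/negPn/negP => px0.
have pp0 : 0 < peval (p * p) x by rewrite pevalM -expr2 exprn_even_gt0.
pose d := peval (p * p) x / 2.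
have d0 : 0 < d by rewrite /d divr_gt0.
have : \forall z \near x, d < peval (p * p) z.
  have /cvgr_gt := @continuous_peval _ (p * p) x; apply.
  by rewrite /d ltr_pdivrMr// mulr_natr mulr2n ltrDl.
move=> /nbhs_ballP[r /= r0 hr].
have [m sub] := tri_sub_box J0.
pose M := `|m| + 1; have M0 : 0 < M by rewrite /M ltr_wpDl.
(* Ratio at most 1 keeps the shrunken triangle inside by convexity; coordinates differ by less than
   [2 * M], so the other bound keeps it in the ball of radius [r]. *)
pose e := Num.min 1 (r / (2 * M)).
have e0 : 0 < e by rewrite /e lt_min ltr01 divr_gt0// mulr_gt0.
have e1 : e <= 1 by rewrite /e ge_min lexx.
have er : e * (2 * M) <= r by rewrite -ler_pdivlMr ?mulr_gt0// /e ge_min lexx orbT.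
pose K := tri (dilate x e a) (dilate x e b) (dilate x e c).
have JK : cross (dilate x e a) (dilate x e b) (dilate x e c) != 0.
  by rewrite cross_dilate mulf_neq0// expf_neq0// gt_eqF.
have Ksub : K `<=` tri a b c.
  by move=> z /(dilate_tri J0 e0)[y yt ->]; apply: tri_convex => //; rewrite (ltW e0).
have close (s u : R) : s \in `[- m, m] -> u \in `[- m, m] -> ball s r (s + e * (u - s)).
  rewrite !in_itv /= => /andP[s1 s2] /andP[u1 u2].
  rewrite /ball /= opprD addNKr normrN normrM (gtr0_norm e0).
  apply: lt_le_trans er; rewrite (ltr_pM2l e0).
  have := ler_norm m; rewrite ltr_norml /M => mm; apply/andP; split; lra.
have Kd z : K z -> d <= peval (p * p) z.
  move=> /(dilate_tri J0 e0)[y yt ->]; apply/ltW/hr.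
  have [xb1 xb2] := sub _ xt; have [yb1 yb2] := sub _ yt.
  by split; apply: close.
have mpp D : measurable D -> measurable_fun D (EFin \o peval (p * p)).
  by move=> mD; apply/measurable_EFinP; apply: measurable_funTS; exact: measurable_peval.
(* The lower bound on [K] and monotonicity in the domain compare this product with the zero
   integral, against the positive area of [K]. *)
have : (d%:E * mu2 K <= 0)%E.
  rewrite -I0 -integral_cst; last exact: measurable_tri.
  apply: (@le_trans _ _ (\int[mu2]_(z in K) (peval (p * p) z)%:E)%E).
    apply: ge0_le_integral => //.
    - exact: measurable_tri.
    - by move=> z _; rewrite lee_fin ltW.
    - by apply: mpp; exact: measurable_tri.
  apply: ge0_subset_integral => //.
  - exact: measurable_tri.
  - exact: measurable_tri.
  - by apply: mpp; exact: measurable_tri.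
  - by move=> z _; rewrite lee_fin pevalM -expr2 sqr_ge0.
rewrite area_tri// -EFinM lee_fin leNgt => /negP; apply.
by rewrite mulr_gt0// divr_gt0// normr_gt0.
Qed.

End Definiteness.

(** * States at rest *)

Section RestStates.
Variables (R : realType) (g : R).
Implicit Types (V W : state R) (n : R * R).

Lemma hh_mkstate (h m w : R) : hh (mkstate h m w) = h.
Proof. by rewrite /hh mxE. Qed.

Lemma mm_mkstate (h m w : R) : mm (mkstate h m w) = m.
Proof. by rewrite /mm mxE. Qed.

Lemma ww_mkstate (h m w : R) : ww (mkstate h m w) = w.
Proof. by rewrite /ww mxE. Qed.

Lemma mkstateP V W : hh V = hh W -> mm V = mm W -> ww V = ww W -> V = W.
Proof.
rewrite /hh /mm /ww => h m w; apply/matrixP => -[[|[|[|//]]] c3] j; rewrite ord1.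
- by rewrite (_ : Ordinal c3 = 0)//; exact: val_inj.
- by rewrite (_ : Ordinal c3 = 1)//; exact: val_inj.
- by rewrite (_ : Ordinal c3 = 2%:R)//; exact: val_inj.
Qed.

(** Here [n] is a normal in edge terms and the gradient of the test function in the volume term. *)
Definition pressure_flux (h : R) n : state R :=
  mkstate 0 (g / 2 * h ^+ 2 * n.1) (g / 2 * h ^+ 2 * n.2).

(** The quotients by the depth have zero numerators, so dry points need no separate case. *)
Lemma fluxdot_rest (h : R) n : fluxdot g (mkstate h 0 0) n = pressure_flux h n.
Proof.
rewrite /fluxdot /fluxF /fluxG !(hh_mkstate, mm_mkstate, ww_mkstate).
apply/matrixP => -[[|[|[|//]]] c3] j; rewrite !mxE /=; ring.
Qed.

(** Equal surface levels make the reconstructed states equal, so the [alpha] term vanishes;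
    [Delta_star] then replaces the reconstructed pressure by the inner one. *)
Lemma modified_flux_rest (alpha h BV hW BW : R) n : h + BV = hW + BW ->
  modified_flux g alpha (mkstate h 0 0) BV (mkstate hW 0 0) BW n =
  pressure_flux h n.
Proof.
move=> eqC; rewrite /modified_flux; set Bm := Num.max BV BW.
have US (k Bk : R) : Ustar (mkstate k 0 0) Bk Bm = mkstate (Num.max 0 (k + Bk - Bm)) 0 0.
  by rewrite /Ustar /hstar !(hh_mkstate, mm_mkstate, ww_mkstate) !mulr0.
rewrite /LF_flux !US -eqC subrr scaler0 subr0 fluxdot_rest /Delta_star /hstar hh_mkstate.
set hs := Num.max _ _; rewrite /pressure_flux.
apply/matrixP => -[[|[|[|//]]] c3] j;
  rewrite !mxE !big_ord_recl big_ord0 !mxE /=; by field.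
Qed.

End RestStates.

(** * Vanishing residual at rest, and recovery of a state from its moments *)

Section WellBalanced.
Variables (R : realType) (T : finType) (g : R) (Om : set (R * R)).
Variables (vtx : T -> 'I_3 -> R * R) (bc : boundary_data R T) (B : dgfun R T).
Hypothesis nd : forall K, Defs.nondegenerate vtx K.
Implicit Types (U V : dgstate R T) (phi : dgfun R T) (K : T) (i : 'I_3)
  (x : R * R) (p : {poly {poly R}}).
Local Notation mu2 := (@lebesgue2 R).

Lemma integrable_triangle p K : mu2.-integrable (triangle vtx K) (EFin \o peval p).
Proof. by rewrite (triangleE (nd K)); apply: integrable_peval; exact: crossK. Qed.

Lemma measurable_triangle K : measurable (triangle vtx K).
Proof. by rewrite (triangleE (nd K)); exact: measurable_tri. Qed.

Lemma edge_sub_triangle K i : edge vtx K i `<=` triangle vtx K.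
Proof.
move=> x [t]; rewrite /= in_itv /= => /andP[t0 t1] <-.
(* Barycentric coordinates of the edge point: [1 - t] and [t] at the ends, 0 at the opposite
   vertex. *)
have [l lE] : exists l : 'I_3 -> R, l = fun j =>
    if j == ordS i then 1 - t else if j == ordS (ordS i) then t else 0 by eexists.
have sumE (f : 'I_3 -> R) : \sum_j l j * f j =
    (1 - t) * f (ordS i) + t * f (ordS (ordS i)).
  rewrite (bigD1 (ordS i))//= (bigD1 (ordS (ordS i)))/=; last first.
    by case: i {lE} => -[|[|[|]]].
  rewrite big1 ?addr0; last first.
    by move=> j /andP[j1 j2]; rewrite lE (negPf j1) (negPf j2) mul0r.
  rewrite lE eqxx; case: ifP => [/eqP e|_]; last by rewrite eqxx.
  by exfalso; move: e; case: i {lE} => -[|[|[|]]].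
exists l; split.
- by move=> j; rewrite lE; case: ifP => _; [rewrite subr_ge0|case: ifP].
- have := sumE (fun=> 1); under eq_bigr do rewrite mulr1.
  by move=> ->; ring.
- by rewrite !sumE /seg_pt /e_src /e_tgt; congr pair; ring.
Qed.

(** Across an interior edge, the point also lies in the closed neighbouring triangle, where the
    state is at rest; on a boundary edge this is the compatibility of the boundary data. *)
Lemma ext_trace_rest k C U K i x : bc_compatible Om vtx bc B k ->
  dg_space3 k U -> nonneg_depth vtx U -> lake_at_rest vtx B C U ->
  edge vtx K i x ->
  exists2 h, (ext_trace Om vtx bc B U K i x).1 = mkstate h 0 0 &
    h + (ext_trace Om vtx bc B U K i x).2 = C.
Proof.
move=> hbc dgU nnU rest xe; rewrite /ext_trace; case E : neighbor => [K'|].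
  have /andP[_ /asboolP[[j eqe] _]] : (K' != K) &&
    `[< (exists j, edge vtx K' j = edge vtx K i) /\
         ~ (edge vtx K i `<=` Defs.boundary Om) >].
    by move: E; rewrite /neighbor; case: pickP => // K'' ? [<-].
  have xK' : triangle vtx K' x by apply: (@edge_sub_triangle K' j); rewrite eqe.
  have [hC m0 w0] := rest _ _ xK'.
  exists (hh (steval U K' x)) => //.
  by apply: mkstateP; rewrite ?hh_mkstate ?mm_mkstate ?ww_mkstate.
have [_ hC m0 w0] := hbc U C dgU nnU rest K i x E xe.
exists (hh (bc U K i x).1) => //.
by apply: mkstateP; rewrite ?hh_mkstate ?mm_mkstate ?ww_mkstate.
Qed.

Lemma eq_segment_integral (a b : R * R) (f f' : R * R -> R) :
  (forall x, segment a b x -> f x = f' x) ->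
  segment_integral a b f = segment_integral a b f'.
Proof.
move=> ff; congr (_ * _); apply: eq_Rintegral => t; rewrite inE => t01.
by apply: ff; exists t.
Qed.

Lemma residual_rest k C U phi K : bc_compatible Om vtx bc B k ->
  dg_space3 k U -> nonneg_depth vtx U -> lake_at_rest vtx B C U ->
  residual g Om vtx bc B U phi K = 0.
Proof.
move=> hbc dgU nnU rest; pose q := C%:P%:P - B K.
have restE x : triangle vtx K x -> steval U K x = mkstate (peval q x) 0 0.
  move=> xK; have [hC m0 w0] := rest _ _ xK; apply: mkstateP.
  - by rewrite hh_mkstate pevalB pevalC -hC addrK.
  - by rewrite mm_mkstate.
  - by rewrite ww_mkstate.
have fluxE i x : edge vtx K i x -> numflux g Om vtx bc B U K i x =
    pressure_flux g (peval q x) (normal vtx K i).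
  move=> xe; rewrite /numflux.
  have [h -> hC] := ext_trace_rest hbc dgU nnU rest xe.
  rewrite restE; last exact: edge_sub_triangle xe.
  by rewrite modified_flux_rest// hC pevalB pevalC subrK.
have resE c : residual g Om vtx bc B U phi K c 0 =
    \int[mu2]_(x in triangle vtx K) (peval (phi K) x *
      source g (peval q x) (peval (dX (B K)) x) (peval (dY (B K)) x) c 0) +
    \int[mu2]_(x in triangle vtx K)
      pressure_flux g (peval q x) (peval (dX (phi K)) x, peval (dY (phi K)) x) c 0 -
    \sum_(i < 3) segment_integral (e_src vtx K i) (e_tgt vtx K i)
      (fun x => peval (phi K) x * pressure_flux g (peval q x) (normal vtx K i) c 0).
  rewrite /residual /elt_integral /edge_integral !mxE; congr (_ + _ - _).
  - apply: eq_Rintegral => x; rewrite inE => xK.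
    by rewrite restE// hh_mkstate mxE.
  - apply: eq_Rintegral => x; rewrite inE => xK.
    by rewrite restE// fluxdot_rest.
  - rewrite summxE; apply: eq_bigr => i _; rewrite mxE.
    by apply: eq_segment_integral => x xe; rewrite fluxE// mxE.
pose P := phi K * ((g / 2)%:P%:P * (q * q)).
(* With [D] either partial derivative, [D (B K) = - D q] and the product rule make source plus flux
   an exact derivative of [P]. *)
have vol (D : {poly {poly R}} -> {poly {poly R}}) x :
    (forall p p', D (p - p') = D p - D p') -> (forall c, D c%:P%:P = 0) ->
    (forall p p', D (p * p') = D p * p' + p * D p') ->
    peval (phi K) x * - (g * peval q x * peval (D (B K)) x) +
    g / 2 * peval q x ^+ 2 * peval (D (phi K)) x = peval (D P) x.
  move=> DB DC DM; rewrite /P !DM DC mul0r add0r.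
  rewrite (_ : D (B K) = - D q); last by rewrite /q DB DC sub0r opprK.
  by rewrite !(pevalD, pevalM, pevalC, pevalN); field.
have intg p : mu2.-integrable (triangle vtx K) (EFin \o peval p).
  exact: integrable_triangle.
have Srcs D : forall x, peval (phi K) x * - (g * peval q x * peval (D (B K)) x) =
    peval (phi K * - (g%:P%:P * q * D (B K))) x.
  by move=> x; rewrite !(pevalM, pevalN, pevalC).
have Flx D : forall x, g / 2 * peval q x ^+ 2 * peval (D (phi K)) x =
    peval ((g / 2)%:P%:P * (q * q) * D (phi K)) x.
  by move=> x; rewrite !(pevalM, pevalC) expr2.
have edgeE (k1 : R) : (fun x => peval (phi K) x * (g / 2 * peval q x ^+ 2 * k1)) =
    (fun x => peval P x * k1).
  by apply/funext => x; rewrite /P !(pevalM, pevalC) expr2 !mulrA.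
have combine D : (forall p p', D (p - p') = D p - D p') -> (forall c, D c%:P%:P = 0) ->
    (forall p p', D (p * p') = D p * p' + p * D p') ->
    \int[mu2]_(x in triangle vtx K) (peval (phi K) x * - (g * peval q x * peval (D (B K)) x)) +
    \int[mu2]_(x in triangle vtx K) (g / 2 * peval q x ^+ 2 * peval (D (phi K)) x) =
    \int[mu2]_(x in triangle vtx K) peval (D P) x.
  move=> DB DC DM; under eq_Rintegral do rewrite Srcs.
  under [X in _ + X]eq_Rintegral do rewrite Flx.
  rewrite -RintegralD//; last exact: measurable_triangle.
  by apply: eq_Rintegral => x _; rewrite -Srcs -Flx vol.
apply/matrixP => c j; rewrite ord1 [RHS]mxE resE.
(* In the depth equation every term is zero; the two momentum equations are the divergence theorem
   for [P] in each direction. *)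
case: c => -[|[|[|//]]] c3.
- under eq_Rintegral do rewrite mxE/= mulr0.
  under [X in _ + X - _]eq_Rintegral do rewrite mxE/=.
  rewrite !Rintegral_cst ?mul0r ?add0r; [|exact: measurable_triangle..].
  rewrite big1 ?oppr0// => i _; rewrite /segment_integral.
  under eq_Rintegral do rewrite mxE/= mulr0.
  by rewrite Rintegral_cst// mul0r mulr0.
- under eq_Rintegral do rewrite mxE/=.
  under [X in _ + X - _]eq_Rintegral do rewrite mxE/=.
  rewrite (combine (@dX R) (@dXB R) (@dXC R) (@dXM R)) divergence_dX//.
  apply/eqP; rewrite subr_eq0; apply/eqP; apply: eq_bigr => i _.
  by rewrite -edgeE; apply: eq_segment_integral => x _; rewrite mxE.
- under eq_Rintegral do rewrite mxE/=.
  under [X in _ + X - _]eq_Rintegral do rewrite mxE/=.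
  rewrite (combine (@dY R) (@dYB R) (@dYC R) (@dYM R)) divergence_dY//.
  apply/eqP; rewrite subr_eq0; apply/eqP; apply: eq_bigr => i _.
  by rewrite -edgeE; apply: eq_segment_integral => x _; rewrite mxE.
Qed.

Lemma mass_inj k U V : dg_space3 k U -> dg_space3 k V ->
  (forall K phi, dg_space k phi -> mass vtx U phi K = mass vtx V phi K) ->
  forall K x, triangle vtx K x -> steval U K x = steval V K x.
Proof.
move=> dgU dgV eqm K x xK; apply/matrixP => c j; rewrite !mxE.
(* The difference of the two components is itself an admissible test function, so the integral of
   its square vanishes. *)
pose phi : dgfun R T := fun K' => U c K' - V c K'.
have dgphi : dg_space k phi.
  by move=> K' i l kil; rewrite !coefB dgU// dgV// subrr.
have /matrixP/(_ c 0) := eqm K phi dgphi; rewrite !mxE.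
have E W : \int[mu2]_(x in triangle vtx K) (peval (phi K) x *: steval W K x) c 0 =
    \int[mu2]_(x in triangle vtx K) peval (phi K * W c K) x.
  by apply: eq_Rintegral => z _; rewrite !mxE pevalM.
rewrite !E => /eqP; rewrite -subr_eq0 -RintegralB; first last.
- exact: integrable_triangle.
- exact: integrable_triangle.
- exact: measurable_triangle.
under eq_Rintegral do rewrite -pevalB -mulrBr.
rewrite (triangleE (nd K)) => /eqP I0.
apply/eqP; rewrite -subr_eq0 -pevalB; apply/eqP.
apply: (peval_square_eq0 (crossK (nd K))); last by rewrite -triangleE.
(* A zero [Rintegral] alone would allow an infinite integral, since [fine] sends infinities to 0;
   integrability excludes this. *)
rewrite -[LHS]fineK; first by congr _%:E; exact: I0.
apply: integrable_fin_num; first exact: measurable_tri.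
exact/integrable_peval/crossK.
Qed.

Lemma lake_at_rest_transfer C U V :
  (forall K x, triangle vtx K x -> steval U K x = steval V K x) ->
  lake_at_rest vtx B C U -> lake_at_rest vtx B C V.
Proof. by move=> UV rest K x xK; rewrite -UV//; exact: rest. Qed.

(** Boundary data are constrained only for states of nonnegative depth, so this property must pass
    from stage to stage. *)
Lemma nonneg_depth_transfer U V :
  (forall K x, triangle vtx K x -> steval U K x = steval V K x) ->
  nonneg_depth vtx U -> nonneg_depth vtx V.
Proof. by move=> UV nn K x xK; rewrite -UV//; exact: nn. Qed.

End WellBalanced.

(** * Lake at rest through the three Runge-Kutta stages *)

Theorem mainTheorem1 (R : realType) (Om : set (R * R)) (T : finType)
    (vtx : T -> 'I_3 -> R * R) (k : nat) (g dt : R)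
    (B : dgfun R T) (bc : boundary_data R T)
    (U0 U1 U2 Un : dgstate R T) (C : R) :
  bounded_polygonal_domain Om ->
  conforming_triangulation vtx Om ->
  (1 <= k)%N -> 0 < g -> 0 < dt ->
  dg_space k B ->
  bc_compatible Om vtx bc B k ->
  dg_space3 k U0 -> dg_space3 k U1 -> dg_space3 k U2 -> dg_space3 k Un ->
  nonneg_depth vtx U0 ->
  rkdg_step g Om vtx bc B k dt U0 U1 U2 Un ->
  lake_at_rest vtx B C U0 ->
  lake_at_rest vtx B C Un.
Proof.
move=> _ [nd _ _] _ _ _ _ hbc dg0 dg1 dg2 dgn nn0 rk rest0.
have resid U phi K : dg_space3 k U -> nonneg_depth vtx U -> lake_at_rest vtx B C U ->
    residual g Om vtx bc B U phi K = 0.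
  by move=> dgU nnU restU; exact: (residual_rest g nd phi K hbc dgU nnU restU).
have mass1 K phi : dg_space k phi -> mass vtx U0 phi K = mass vtx U1 phi K.
  by move=> /(rk K)[-> _ _]; rewrite resid// scaler0 addr0.
have eq1 := mass_inj nd dg0 dg1 mass1.
have rest1 := lake_at_rest_transfer eq1 rest0.
have nn1 := nonneg_depth_transfer eq1 nn0.
(* With zero residual the stage is a weighted mean of equal moments, its weights summing to 1. *)
have mass2 K phi : dg_space k phi -> mass vtx U0 phi K = mass vtx U2 phi K.
  move=> dgphi; have [_ -> _] := rk K phi dgphi.
  rewrite resid// scaler0 addr0 -mass1// -scalerDl (_ : 3 / 4 + 1 / 4 = 1) ?scale1r//.
  by field.
have eq2 := mass_inj nd dg0 dg2 mass2.
have rest2 := lake_at_rest_transfer eq2 rest0.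
have nn2 := nonneg_depth_transfer eq2 nn0.
have massn K phi : dg_space k phi -> mass vtx U0 phi K = mass vtx Un phi K.
  move=> dgphi; have [_ _ ->] := rk K phi dgphi.
  rewrite resid// scaler0 addr0 -mass2// -scalerDl (_ : 1 / 3 + 2 / 3 = 1) ?scale1r//.
  by field.
exact: lake_at_rest_transfer (mass_inj nd dg0 dgn massn) rest0.
Qed.
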